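(* Let $f(\theta)=\sum_{k=0}^{\infty}a_k\theta^k$ be a power series with $a_k>0$ for all $k\ge 0$ and positive radius of convergence $R_1\in(0,\infty]$. Suppose $\{b_k:k\ge 0\}$ is an unbounded sequence of real numbers such that $b_0=1$, $b_k\ge 1$ for all $k\ge 1$, the set $\{k\ge 0:b_k=1\}$ is finite, and $\lim_{k\to\infty}b_k^{1/k}=L$ for some finite $L>0$. Then the radius of convergence $R_2$ of the power series $h(\theta):=\sum_{k=0}^{\infty}b_k^2a_k\theta^k$ is given by $R_2=R_1/L^2$. Consequently, $\{b_k:k\ge 0\}$ satisfies the following condition (A) with respect to $f$: the sequence $\{b_k\}$ is unbounded, $b_0=1$, $b_k\ge 1$ for all $k\ge 1$, the set $\{k\ge 0:b_k=1\}$ is finite, and the power series $\sum_{k=0}^{\infty}b_k^2a_k\theta^k$ has positive radius of convergence.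
   Context: Radii of convergence take values in $[0,\infty]$; if $R_1=+\infty$ then $R_1/L^2$ is understood as $+\infty$, and a ''positive'' radius of convergence may be $+\infty$. *)

(* Defs.v *)
From Stdlib Require Import Reals Finite_sets.
From Coquelicot Require Import Coquelicot.
Open Scope R_scope.

(** Power series are represented by their coefficient sequences; the radius of
    convergence is Coquelicot's [CV_radius], with values in [Rbar]. *)

Definition unbounded_seq (b : nat -> R) : Prop :=
  ~ exists M : R, forall k : nat, Rabs (b k) <= M.

Definition positive_radius (a : nat -> R) : Prop :=
  Rbar_lt 0 (CV_radius a).

(** Coefficients of [h], where [a] are the coefficients of [f]. *)
Definition h_coef (a b : nat -> R) : nat -> R := fun k => b k ^ 2 * a k.

(** Condition (A) for [b] with respect to the power series with coefficients
    [a]. *)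
Record condition_A (a b : nat -> R) : Prop := {
  condA_unbounded : unbounded_seq b;
  condA_b0 : b 0%nat = 1;
  condA_ge1 : forall k : nat, (1 <= k)%nat -> 1 <= b k;
  condA_finite : Finite_sets.Finite nat (fun k : nat => b k = 1);
  condA_radius : positive_radius (h_coef a b)
}.

(** [x^(1/k)] for [x > 0]; the value at [k = 0] is junk and does not affect
    limits as [k] tends to infinity. *)
Definition kth_root (k : nat) (x : R) : R := Rpower x (1 / INR k).

(* Main.v *)
(** Writing [x_k = b_k^(1/k)], we have [b_k^2 = (x_k^2)^k] with [x_k^2] tending
    to [L^2]. So for [t < L^2 < s], eventually [t^k a_k <= b_k^2 a_k <= s^k a_k],
    which gives [t R_2 <= R_1 <= s R_2]; let [s] and [t] tend to [L^2]. *)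

Require Import Defs.
From Stdlib Require Import Reals Finite_sets Lra Lia.
From Coquelicot Require Import Coquelicot.
Open Scope R_scope.

Lemma bounded_of_eventually (u : nat -> R) (M : R) :
  eventually (fun n => Rabs (u n) <= M) ->
  exists M' : R, forall n : nat, Rabs (u n) <= M'.
Proof.
intros [N HN].
assert (Hinit : exists B, forall n, (n < N)%nat -> Rabs (u n) <= B).
{ clear HN; induction N as [|N [B HB]].
  - exists 0; intros n Hn; lia.
  - exists (Rmax B (Rabs (u N))); intros n Hn.
    destruct (Nat.eq_dec n N) as [->|Hne]; [apply Rmax_r|].
    apply Rle_trans with B; [apply HB; lia|apply Rmax_l]. }
destruct Hinit as [B HB].
exists (Rmax B M); intros n.
destruct (Nat.le_gt_cases N n) as [Hn|Hn].
- apply Rle_trans with M; [now apply HN|apply Rmax_r].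
- apply Rle_trans with B; [now apply HB|apply Rmax_l].
Qed.

(** The radius is the least upper bound of the [r] for which [a n * r ^ n] stays bounded, and, up to
    finitely many terms, the same bound controls [c n * (r / q) ^ n]. Testing with a real [x] below
    the radius, instead of comparing two radii, avoids arithmetic with infinite values. *)
Lemma CV_radius_geometric_le (a c : nat -> R) (q x : R) :
  0 < q -> eventually (fun n => Rabs (c n) <= q ^ n * Rabs (a n)) ->
  Rbar_le x (CV_radius a) -> Rbar_le (x / q) (CV_radius c).
Proof.
intros Hq Hev Hx.
destruct (CV_radius_bounded a) as [_ Hleast].
destruct (CV_radius_bounded c) as [Hub _].
assert (Hscale : forall r, (exists M, forall n, Rabs (a n * r ^ n) <= M) ->
  Rbar_le (r / q) (CV_radius c)).
{ intros r [M HM]; apply Hub.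
  apply bounded_of_eventually with M.
  destruct Hev as [N HN]; exists N; intros n Hn.
  apply Rle_trans with (2 := HM n).
  assert (Hqn : 0 < q ^ n) by now apply pow_lt.
  rewrite !Rabs_mult; unfold Rdiv.
  rewrite Rpow_mult_distr, pow_inv, Rabs_mult.
  rewrite (Rabs_right (/ q ^ n)) by (left; now apply Rinv_0_lt_compat).
  replace (Rabs (a n) * Rabs (r ^ n))
    with (q ^ n * Rabs (a n) * (Rabs (r ^ n) * / q ^ n)) by (field; lra).
  apply Rmult_le_compat_r; [|now apply HN].
  apply Rmult_le_pos; [apply Rabs_pos|].
  left; now apply Rinv_0_lt_compat. }
destruct (CV_radius c) as [rho| |] eqn:Erho; [|exact I|].
- assert (Hle : Rbar_le (CV_radius a) (q * rho)).
  { apply Hleast; intros r Hr; specialize (Hscale r Hr); simpl in *.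
    replace r with (q * (r / q)) by (field; lra).
    apply Rmult_le_compat_l; lra. }
  pose proof (Rbar_le_trans _ _ _ Hx Hle) as Hxr; simpl in *.
  apply Rmult_le_reg_l with q; [lra|].
  now replace (q * (x / q)) with x by (field; lra).
- pose proof (CV_radius_ge_0 c) as H0; rewrite Erho in H0; destruct H0.
Qed.

Lemma kth_root_pow (k : nat) (x : R) :
  (1 <= k)%nat -> 0 < x -> kth_root k x ^ k = x.
Proof.
intros Hk Hx; unfold kth_root.
assert (HINR : INR k <> 0) by (apply not_0_INR; lia).
rewrite <- Rpower_pow by apply exp_pos.
rewrite Rpower_mult.
replace (1 / INR k * INR k) with 1 by now field.
now apply Rpower_1.
Qed.

Lemma kth_root_lim_pow_between (c : nat -> R) (l s t : R) :
  (forall k, 0 < c k) -> 0 < t < l -> l < s ->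
  is_lim_seq (fun k => kth_root k (c k)) l ->
  eventually (fun k => t ^ k <= c k <= s ^ k).
Proof.
intros Hc Ht Hs Hlim.
assert (Hopen : locally l (fun y => t < y < s)).
{ apply (open_and (fun y => t < y) (fun y => y < s));
    [apply open_gt|apply open_lt|lra]. }
destruct (Hlim _ Hopen) as [N HN].
(* [S N] skips [k = 0], where taking the [k]-th power does not undo [kth_root]. *)
exists (S N); intros k Hk.
specialize (HN k ltac:(lia)).
rewrite <- (kth_root_pow k (c k)) by (try lia; apply Hc).
split; apply pow_incr; lra.
Qed.

(** To be applied with [c k = b k ^ 2] and [l = L ^ 2]. Both radii may be infinite, so the two
    comparisons are first proved for real test points and then used in each finite or infinite
    case. *)
Lemma CV_radius_mult_root_lim (a c : nat -> R) (l : R) :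
  (forall k, 0 < c k) -> 0 < l ->
  is_lim_seq (fun k => kth_root k (c k)) l ->
  CV_radius (fun k => c k * a k) = Rbar_div (CV_radius a) l.
Proof.
intros Hc Hl Hlim.
assert (Hlower : forall s x : R, l < s -> Rbar_le x (CV_radius a) ->
  Rbar_le (x / s) (CV_radius (fun k => c k * a k))).
{ intros s x Hs; apply CV_radius_geometric_le; [lra|].
  (* Any lower bound in [(0, l)] would do; [l / 2] is one. *)
  destruct (kth_root_lim_pow_between c l s (l / 2)) as [N HN];
    [assumption|lra|assumption|assumption|].
  exists N; intros n Hn; specialize (HN n Hn).
  rewrite Rabs_mult, (Rabs_right (c n)) by (left; apply Hc).
  apply Rmult_le_compat_r; [apply Rabs_pos|apply HN]. }
assert (Hupper : forall t y : R, 0 < t < l ->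
  Rbar_le y (CV_radius (fun k => c k * a k)) ->
  Rbar_le (y * t) (CV_radius a)).
{ intros t y Ht Hy.
  (* Same comparison with the two series exchanged and [q = / t]: eventually [t ^ n <= c n], so
     [Rabs (a n) <= (/ t) ^ n * Rabs (c n * a n)]. *)
  replace (y * t) with (y / / t) by (field; lra).
  revert Hy; apply CV_radius_geometric_le; [apply Rinv_0_lt_compat; lra|].
  destruct (kth_root_lim_pow_between c l (l + 1) t) as [N HN];
    [assumption|lra|lra|assumption|].
  exists N; intros n Hn; specialize (HN n Hn).
  assert (Htn : 0 < t ^ n) by (apply pow_lt; lra).
  rewrite Rabs_mult, (Rabs_right (c n)) by (left; apply Hc).
  rewrite pow_inv, <- Rmult_assoc.
  rewrite <- (Rmult_1_l (Rabs (a n))) at 1.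
  apply Rmult_le_compat_r; [apply Rabs_pos|].
  apply Rmult_le_reg_l with (t ^ n); [assumption|].
  replace (t ^ n * (/ t ^ n * c n)) with (c n) by (field; lra).
  lra. }
pose proof (CV_radius_ge_0 a) as Ha0.
pose proof (CV_radius_ge_0 (fun k => c k * a k)) as Hh0.
destruct (CV_radius a) as [r| |]; [| |destruct Ha0];
  destruct (CV_radius (fun k => c k * a k)) as [h| |];
  try (now destruct Hh0); simpl in Ha0, Hh0.
- simpl; f_equal.
  assert (H1 : r <= h * l).
  { apply Rle_plus_epsilon; intros eps Heps.
    (* With [s = l + d] the comparison gives [r <= h * l + h * d], and [h * d <= eps]. The
       denominator is [h + 1] because [h] may be zero. *)
    set (d := eps / (h + 1)).
    assert (Hd : 0 < d) by (apply Rdiv_lt_0_compat; lra).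
    assert (Ed : d * (h + 1) = eps) by (unfold d; field; lra).
    assert (Hr : r / (l + d) <= h) by (apply Hlower; [lra|simpl; lra]).
    apply (Rmult_le_compat_r (l + d)) in Hr; [|lra].
    replace (r / (l + d) * (l + d)) with r in Hr by (field; lra).
    nra. }
  assert (H2 : h * l <= r).
  { apply Rnot_lt_le; intros Hlt.
    assert (Hh : 0 < h) by nra.
    (* Since [r / h < l], the midpoint [t] is an admissible lower bound exceeding [r / h], so
       [h * t > r], against the comparison. *)
    set (t := (r / h + l) / 2).
    assert (Erh : h * (r / h) = r) by (field; lra).
    assert (Hrh : 0 <= r / h) by (apply Rle_div_r; lra).
    assert (Hrl : r / h < l) by nra.
    assert (Ht : h * t <= r)
      by (apply Hupper; [unfold t; lra|simpl; lra]).
    unfold t in Ht; nra. }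
  apply Rmult_eq_reg_r with l; [|lra].
  replace (r * / l * l) with r by (field; lra); lra.
(* An infinite radius admits every test point; this one is chosen to yield [r + 1 <= r]. *)
- specialize (Hupper (l / 2) ((r + 1) / (l / 2)) ltac:(lra) I); simpl in Hupper.
  replace ((r + 1) / (l / 2) * (l / 2)) with (r + 1) in Hupper by (field; lra).
  lra.
(* Likewise, this test point yields [h + 1 <= h]. *)
- specialize (Hlower (l + 1) ((h + 1) * (l + 1)) ltac:(lra) I); simpl in Hlower.
  replace ((h + 1) * (l + 1) / (l + 1)) with (h + 1) in Hlower by (field; lra).
  lra.
- symmetry; apply is_Rbar_mult_unique, is_Rbar_mult_p_infty_pos.
  simpl; now apply Rinv_0_lt_compat.
Qed.

Lemma Rbar_div_pos_pos (x : Rbar) (l : R) :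
  0 < l -> Rbar_lt 0 x -> Rbar_lt 0 (Rbar_div x l).
Proof.
intros Hl Hx; destruct x as [r| |]; [| |destruct Hx].
- now apply Rdiv_lt_0_compat.
- assert (E : Rbar_div p_infty l = p_infty); [|now rewrite E].
  apply is_Rbar_mult_unique, is_Rbar_mult_p_infty_pos.
  simpl; now apply Rinv_0_lt_compat.
Qed.

Theorem theorem2 (a b : nat -> R) (L : R)
  (a_pos : forall k : nat, 0 < a k)
  (f_radius : positive_radius a)
  (b_unbounded : unbounded_seq b)
  (b0 : b 0%nat = 1)
  (b_ge1 : forall k : nat, (1 <= k)%nat -> 1 <= b k)
  (b_finite : Finite_sets.Finite nat (fun k : nat => b k = 1))
  (L_pos : 0 < L)
  (b_lim : is_lim_seq (fun k : nat => kth_root k (b k)) (Rbar.Finite L)) :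
  CV_radius (h_coef a b) = Rbar_div (CV_radius a) (Rbar.Finite (L ^ 2)) /\
  condition_A a b.
Proof.
assert (b_pos : forall k, 0 < b k).
{ intros [|k]; [lra|specialize (b_ge1 (S k) ltac:(lia)); lra]. }
assert (L2_pos : 0 < L ^ 2) by now apply pow_lt.
assert (Hrad : CV_radius (h_coef a b) = Rbar_div (CV_radius a) (L ^ 2)).
{ apply CV_radius_mult_root_lim; [intros k; now apply pow_lt|assumption|].
  (* The root of a square is the square of the root, at [k = 0] too, since [Rpower] is
     multiplicative on positive bases for every exponent. *)
  apply is_lim_seq_ext with (fun k => kth_root k (b k) * kth_root k (b k)).
  - intros k; unfold kth_root; simpl; rewrite Rmult_1_r.
    now apply Rpower_mult_distr.
  - replace (L ^ 2) with (L * L) by ring.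
    now apply (is_lim_seq_mult' _ _ L L). }
split; [assumption|split; try assumption].
unfold positive_radius; rewrite Hrad; now apply Rbar_div_pos_pos.
Qed.
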